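(* Let $S_1$ and $S_2$ be two numerical semigroups and assume that at least one of them is not symmetric. Then every gluing of $S_1$ and $S_2$ is not nearly Gorenstein.
   Context: A numerical semigroup is a submonoid $S$ of $\mathbb{N}=\{0,1,2,\dots\}$ with $\mathbb{N}\setminus S$ finite. Every numerical semigroup has a unique minimal set of generators, denoted $\mathrm{G}(S)$, which is finite. $\mathrm{F}(S)=\max(\mathbb{Z}\setminus S)$ is the Frobenius number. $\mathrm{PF}(S)=\{f\in\mathbb{Z}\setminus S : f+s\in S \text{ for all } s\in S\setminus\{0\}\}$ is the set of pseudo-Frobenius numbers. $S$ is symmetric if $\mathrm{PF}(S)=\{\mathrm{F}(S)\}$. Put $M(S)=S\setminus\{0\}$, $K(S)=\{z\in\mathbb{Z} : \mathrm{F}(S)-z\notin S\}$, and $S-K(S)=\{z\in\mathbb{Z} : z+K(S)\subseteq S\}$. $S$ is nearly Gorenstein if $M(S)\subseteq K(S)+(S-K(S))$. Gluing: let $S_1=\langle n_1,\dots,n_\nu\rangle$ and $S_2=\langle m_1,\dots,m_\mu\rangle$ be numerical semigroups, and let $x\in S_2\setminus\mathrm{G}(S_2)$ and $y\in S_1\setminus\mathrm{G}(S_1)$ be coprime integers. The gluing of $S_1$ and $S_2$ with respect to $x$ and $y$ is the numerical semigroup $\langle xS_1,yS_2\rangle=\langle xn_1,\dots,xn_\nu,ym_1,\dots,ym_\mu\rangle$ (where $\langle\cdots\rangle$ denotes the set of all $\mathbb{N}$-linear combinations). *)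

(* Defs.v *)
From HB Require Import structures.
From mathcomp Require Import all_boot all_order all_algebra.
From mathcomp Require Import boolp classical_sets cardinality.
From mathcomp Require Import zify.

Set Implicit Arguments.
Unset Strict Implicit.
Unset Printing Implicit Defensive.

Import Order.TTheory GRing.Theory Num.Theory.
Local Open Scope classical_set_scope.
Local Open Scope nat_scope.

Definition numerical_semigroup (S : set nat) : Prop :=
  [/\ S 0, (forall a b, S a -> S b -> S (a + b)) & finite_set (~` S)].

Definition generated (A : set nat) : set nat :=
  [set n | exists (k : nat) (c g : 'I_k -> nat),
     (forall i, A (g i)) /\ n = \sum_(i < k) c i * g i].

Definition minimal_generating_set (S A : set nat) : Prop :=
  generated A = S /\ forall B, B `<=` A -> generated B = S -> B = A.

(* The default value is irrelevant for a numerical semigroup, by lemma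
   [minimal_generatorsP] below. *)
Definition minimal_generators (S : set nat) : set nat :=
  xget set0 [set A | minimal_generating_set S A].

Definition intset (S : set nat) : set int := [set n%:Z%R | n in S].

Definition is_frobenius_number (S : set nat) (f : int) : Prop :=
  ~ intset S f /\ forall z : int, ~ intset S z -> (z <= f)%R.

(* The default value is irrelevant for a numerical semigroup, by lemma
   [frobenius_numberP] below; [frobenius_number setT] is -1. *)
Definition frobenius_number (S : set nat) : int :=
  xget 0%R [set f | is_frobenius_number S f].

Definition pseudo_frobenius (S : set nat) : set int :=
  [set f | ~ intset S f /\
     forall s : nat, S s -> s <> 0 -> intset S (f + s%:Z)%R].

Definition symmetric_semigroup (S : set nat) : Prop :=
  pseudo_frobenius S = [set frobenius_number S].

Definition maximal_ideal (S : set nat) : set int := intset (S `\ 0).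

Definition canonical_ideal (S : set nat) : set int :=
  [set z | ~ intset S (frobenius_number S - z)%R].

Definition ideal_sum (A B : set int) : set int :=
  [set (a + b)%R | a in A & b in B].

Definition ideal_colon (A B : set int) : set int :=
  [set z | forall b, B b -> A (z + b)%R].

Definition nearly_gorenstein (S : set nat) : Prop :=
  maximal_ideal S `<=`
    ideal_sum (canonical_ideal S)
              (ideal_colon (intset S) (canonical_ideal S)).

(* By lemma [gluing_generators] below, S1 and S2 may be replaced here by any
   systems of generators. *)
Definition gluing (S1 S2 : set nat) (x y : nat) : set nat :=
  generated ([set x * s | s in S1] `|` [set y * s | s in S2]).

Definition is_gluing (S1 S2 S : set nat) : Prop :=
  exists x y : nat,
    [/\ (S2 `\` minimal_generators S2) x,
        (S1 `\` minimal_generators S1) y,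
        coprime x y
      & S = gluing S1 S2 x y].

Lemma generated0 A : generated A 0.
Proof.
exists 0, (fun _ => 0), (fun _ => 0); split; first by case.
by rewrite big_ord0.
Qed.

Lemma generatedD A a b :
  generated A a -> generated A b -> generated A (a + b).
Proof.
move=> [k [c [g [gA ->]]]] [l [d [h [hA ->]]]].
exists (k + l).
exists (fun i => match split i with inl j => c j | inr j => d j end).
exists (fun i => match split i with inl j => g j | inr j => h j end); split.
  by move=> i; case: (split i).
rewrite big_split_ord /=; congr (_ + _); apply: eq_bigr => i _.
  by rewrite -[lshift l i]/(unsplit (inl i)) unsplitK.
by rewrite -[rshift k i]/(unsplit (inr i)) unsplitK.
Qed.

Lemma sub_generated A : A `<=` generated A.
Proof.
move=> a Aa; exists 1, (fun _ => 1), (fun _ => a); split=> //.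
by rewrite big_ord1 mul1n.
Qed.

Lemma generated_min (A T : set nat) :
  T 0 -> (forall a b, T a -> T b -> T (a + b)) -> A `<=` T ->
  generated A `<=` T.
Proof.
move=> T0 TD AT _ [k [c [g [gA ->]]]]; apply: (big_ind T) => // i _.
by elim: (c i) => [|n IHn]; rewrite ?mul0n// mulSn; apply: TD => //; apply: AT.
Qed.

Lemma minimal_generating_set_unique S :
  numerical_semigroup S -> exists! A, minimal_generating_set S A.
Proof.
move=> [S0 SD _].
pose I := [set a | [/\ S a, a <> 0 &
  forall b c, S b -> S c -> a = b + c -> b = 0 \/ c = 0]].
have IA A : generated A = S -> I `<=` A.
  move=> AS a [Sa a0 Ia]; apply: contrapT => Aa.
  have AT : A `<=` S by rewrite -AS; exact: sub_generated.
  have genAa : generated A a by rewrite AS.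
  suff /(_ a genAa)[_] :
    generated A `<=` [set n | S n /\ (n = a -> False)] by apply.
  have T0 : [set n | S n /\ (n = a -> False)] 0 by split=> // /esym.
  apply: generated_min => //.
  - move=> b c [Sb ba] [Sc ca]; split; first exact: SD.
    move=> /esym E; case: (Ia b c Sb Sc E) => E0.
      by apply: ca; rewrite E E0.
    by apply: ba; rewrite E E0 addn0.
  - by move=> b Ab; split; [exact: AT|move=> ba; apply: Aa; rewrite -ba].
have IS : generated I = S.
  apply/seteqP; split; first by apply: generated_min => // a [].
  move=> a; have [n] := ubnP a; elim: n a => // n IHn a an Sa.
  have [->|/eqP a0] := eqVneq a 0; first exact: generated0.
  have [Ia|nIa] := pselect (I a); first exact: sub_generated.
  have [b [c [Sb Sc E b0 c0]]] :
    exists b c, [/\ S b, S c, a = b + c, b <> 0 & c <> 0].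
    apply: contrapT => H; apply: nIa; split=> // b c Sb Sc E.
    apply: contrapT => /not_orP[b0 c0]; apply: H; by exists b, c.
  by rewrite E; apply: generatedD; apply: IHn => //; lia.
exists I; split.
  split=> // B BI BS; apply/seteqP; split=> //; exact: IA.
by move=> A [AS Amin]; apply: Amin => //; exact: IA.
Qed.

Lemma minimal_generatorsP S A : numerical_semigroup S ->
  minimal_generating_set S A <-> A = minimal_generators S.
Proof.
move=> /minimal_generating_set_unique[B [BS Bu]].
have E : minimal_generators S = B.
  rewrite /minimal_generators; case: xgetP => [C _ /Bu //|/(_ B)]; exact.
by rewrite E; split=> [/Bu //|->].
Qed.

Lemma frobenius_numberP S f : numerical_semigroup S ->
  is_frobenius_number S f <-> f = frobenius_number S.
Proof.
move=> [S0 _ finS].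
have Fu g h : is_frobenius_number S g -> is_frobenius_number S h -> g = h.
  by move=> [g1 g2] [h1 h2]; apply/eqP; rewrite eq_le g2 // h2.
have intS (n : nat) : intset S n%:Z%R -> S n by case=> m Sm [<-].
have [g Fg] : exists g, is_frobenius_number S g.
  have [N SN] : exists N, forall n, N <= n -> S n.
    have [s sE] := (finite_seqP _).1 finS.
    exists (\max_(i <- s) i).+1 => n nN; apply: contrapT => Sn.
    have ns : n \in s by have : (~` S) n by []; rewrite sE.
    by have := leq_bigmax_seq (F := id) (P := xpredT) n ns isT; rewrite /= leqNgt nN.
  elim: N SN => [|N IHN] SN.
    exists (-1)%R; split; first by case.
    move=> [n|n] Sn; last by lia.
    by case: Sn; exists n => //; apply: SN.
  have [SNN|nSN] := pselect (S N).
    apply: IHN => n; rewrite leq_eqVlt => /orP[/eqP <- //|]; exact: SN.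
  exists N%:Z%R; split; first by move/intS.
  move=> [n|n] Sn; last by lia.
  have [nN|Nn] := leqP n N; first by lia.
  by case: Sn; exists n => //; apply: SN.
have E : frobenius_number S = g.
  rewrite /frobenius_number; case: xgetP => [h _ Fh|/(_ g) //]; exact: Fu.
by rewrite E; split=> [/Fu|->]; [exact|].
Qed.

Lemma gluing_generators (S1 S2 A1 A2 : set nat) (x y : nat) :
  generated A1 = S1 -> generated A2 = S2 ->
  gluing S1 S2 x y =
    generated ([set x * a | a in A1] `|` [set y * a | a in A2]).
Proof.
move=> <- <-; apply/seteqP; split; apply: generated_min;
  try exact: generated0; try exact: generatedD; last first.
  by move=> _ [[a Aa <-]|[a Aa <-]]; apply: sub_generated; [left|right];
    exists a => //; apply: sub_generated.
set G := generated (_ `|` _).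
have GM z A : (forall a, A a -> G (z * a)) -> forall a, generated A a -> G (z * a).
  move=> AG; apply: (@generated_min A [set a | G (z * a)]) => //=.
    by rewrite muln0; exact: generated0.
  by move=> a b Ga Gb; rewrite mulnDr; exact: generatedD.
by move=> _ [[a Aa <-]|[a Aa <-]]; apply: (GM _ _ _ _ Aa) => b Ab;
  apply: sub_generated; [left|right]; exists b.
Qed.

(* Main.v *)
Require Import Defs.
From mathcomp Require Import all_boot all_order all_algebra.
From mathcomp Require Import boolp classical_sets cardinality.
From mathcomp Require Import zify ring.

(** Let [F], [F1], [F2] and [K], [K1], [K2] be the Frobenius numbers and the
    canonical ideals of the gluing [S] and of [S1], [S2].  Then
    [F = x F1 + y F2 + x y] and [K = x K1 + y K2].  Since [x] is not a minimal
    generator of [S2], there is [m] in [S2] with [0 < m < x].  If [S] is nearly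
    Gorenstein, then [y m = (x k1 + y k2) + w] with [k1] in [K1], [k2] in [K2]
    and [w + K] contained in [S].  For [k] in [K1] we get
    [w + x k + y k2 = x (k - k1) + y m] in [S], and [m < x] forces [k - k1] to
    be in [S1].  Hence [K1] is contained in [k1 + S1], which makes [S1]
    symmetric.  Exchanging the roles of [S1] and [S2] settles the other case. *)

Set Implicit Arguments.
Unset Strict Implicit.
Unset Printing Implicit Defensive.

Import Order.TTheory GRing.Theory Num.Theory.
Local Open Scope classical_set_scope.
Local Open Scope ring_scope.

(** * Integer combinations of a coprime pair *)

Lemma coprime_mul_eq (x y : nat) (p q : int) : (0 < x)%N -> coprime x y ->
  x%:Z * p = y%:Z * q -> exists t : int, p = y%:Z * t /\ q = x%:Z * t.
Proof.
move=> x0 cxy E.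
have : (x%:Z %| y%:Z * q)%Z by rewrite -E dvdz_mulr.
rewrite Gauss_dvdzr // => /dvdzP[t Et]; exists t; split; last by rewrite Et mulrC.
have xn0 : x%:Z != 0 by lia.
by apply: (mulfI xn0); rewrite E Et; ring.
Qed.

Lemma bezout_int (x y : nat) (z : int) : coprime x y ->
  exists u v : int, z = x%:Z * u + y%:Z * v.
Proof.
move=> cxy; have [u [v E]] := Bezoutz x%:Z y%:Z.
have g1 : gcdz x%:Z y%:Z = 1 by apply/eqP.
exists (z * u), (z * v).
by rewrite -[LHS]mulr1 -g1 -E; ring.
Qed.

(** * Frobenius number, canonical ideal and symmetry of one semigroup *)

Section NumericalSemigroup.
Variable S : set nat.
Hypothesis hS : numerical_semigroup S.

Let F := frobenius_number S.

Lemma intset_ge0 z : intset S z -> 0 <= z.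
Proof. by case=> n _ <-. Qed.

Lemma intset0 : intset S 0.
Proof. by case: hS => S0 _ _; exists 0%N. Qed.

Lemma intsetD a b : intset S a -> intset S b -> intset S (a + b).
Proof.
case: hS => _ SD _ [m Sm <-] [n Sn <-].
by exists (m + n)%N; [exact: SD|rewrite PoszD].
Qed.

Lemma intsetM (x : nat) (t : int) : S x -> 0 <= t -> intset S (x%:Z * t).
Proof.
case: t => // n Sx _; elim: n => [|n IHn]; first by rewrite mulr0; exact: intset0.
have -> : x%:Z * n.+1%:Z = x%:Z + x%:Z * n%:Z by rewrite -addn1 PoszD; ring.
by apply: intsetD => //; exists x.
Qed.

Lemma frobenius_notin : ~ intset S F.
Proof. by have [] := (frobenius_numberP F hS).2 erefl. Qed.

Lemma le_frobenius z : ~ intset S z -> z <= F.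
Proof. by have [_] := (frobenius_numberP F hS).2 erefl; apply. Qed.

Lemma intset_gt_frobenius z : F < z -> intset S z.
Proof. by move=> Fz; apply: contrapT => /le_frobenius; lia. Qed.

Lemma canonical_ideal0 : canonical_ideal S 0.
Proof. by rewrite /canonical_ideal /= subr0; exact: frobenius_notin. Qed.

Lemma canonical_ideal_ge0 z : canonical_ideal S z -> 0 <= z.
Proof. by move=> /le_frobenius; rewrite /F; lia. Qed.

(* The element found is the member of the Apery set of [S] with respect to [x]
   in the class of [v] modulo [x]. *)
Lemma apery_congr (x : nat) (v : int) : (0 < x)%N ->
  exists t : int, intset S (v + x%:Z * t) /\ ~ intset S (v + x%:Z * t - x%:Z).
Proof.
(* This shift makes [v - x N] negative, so [P 0] fails and the least index satisfying [P] has a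
   predecessor. *)
move=> x0; pose N : int := `|v| + 1.
pose P n := `[< intset S (v + x%:Z * (n%:Z - N)) >].
have exP : exists n, P n.
  exists (absz (N + `|F| + `|v| + 1)); apply/asboolP/intset_gt_frobenius.
  by rewrite /N; nia.
case: (ex_minnP exP) => n /asboolP Sn nmin.
exists (n%:Z - N); split=> // Sn1.
have [n0|n0] := posnP n.
  by move: (intset_ge0 Sn); rewrite n0 /N; nia.
have : P n.-1.
  apply/asboolP; move: Sn1; congr (intset S _).
  have -> : n%:Z = n.-1%:Z + 1 by lia.
  by ring.
by move/nmin; lia.
Qed.

(** Since [0] is the least element of the canonical ideal, [k1 = 0], so that ideal lies in [S]. A
    pseudo-Frobenius [f <> F] would then give [F - f] in [S], nonzero, and [F = f + (F - f)] would
    lie in [S]. *)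
Lemma canonical_ideal_principal k1 : canonical_ideal S k1 ->
  (forall k, canonical_ideal S k -> intset S (k - k1)) ->
  symmetric_semigroup S.
Proof.
move=> Kk1 Sk.
have k10 : k1 = 0.
  have := intset_ge0 (Sk _ canonical_ideal0).
  by have := canonical_ideal_ge0 Kk1; lia.
apply/seteqP; split=> [f [nSf fS]|_ ->]; last first.
  split; first exact: frobenius_notin.
  by move=> s _ s0; apply: intset_gt_frobenius; rewrite /F; lia.
have : intset S (F - f).
  by apply: contrapT => /Sk; rewrite k10 subr0.
move=> [s Ss E]; apply: contrapT => /= fF.
apply: frobenius_notin; have -> : F = f + s%:Z by rewrite E; ring.
by apply: fS => // s0; apply: fF; move: E; rewrite s0 /F; lia.
Qed.

(** Otherwise [S] without [x] would be a submonoid containing all minimal generators, hence would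
    contain [x]. *)
Lemma nonminimal_generator_gt x : (S `\` minimal_generators S) x -> x <> 0%N ->
  exists m, [/\ S m, (0 < m)%N & (m < x)%N].
Proof.
case: (hS) => S0 SD _ [Sx nGx] x0; apply: contrapT => nex.
have [gG _] := (minimal_generatorsP _ hS).2 (erefl (minimal_generators S)).
have GS : minimal_generators S `<=` S by rewrite -{2}gG; exact: sub_generated.
have : generated (minimal_generators S) x by rewrite gG.
suff H : generated (minimal_generators S) `<=` [set n | S n /\ n <> x].
  by move/H => [].
apply: generated_min => /=.
- by split=> // /esym.
- move=> a b [Sa ax] [Sb bx]; split; first exact: SD.
  move=> abx; have [a0|a0] := posnP a; first by lia.
  by apply: nex; exists a; split=> //; lia.
- by move=> a Ga; split; [exact: GS|move=> ax; apply: nGx; rewrite -ax].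
Qed.

End NumericalSemigroup.

(** * Frobenius number and canonical ideal of a gluing *)

Section Gluing.
Variables (S1 S2 : set nat) (x y : nat).
Hypotheses (hS1 : numerical_semigroup S1) (hS2 : numerical_semigroup S2).
Hypotheses (S2x : S2 x) (S1y : S1 y) (x0 : (0 < x)%N) (cxy : coprime x y).

Let S := gluing S1 S2 x y.
Let F1 := frobenius_number S1.
Let F2 := frobenius_number S2.

Lemma intset_gluing z : intset S z <->
  exists a b, [/\ intset S1 a, intset S2 b & z = x%:Z * a + y%:Z * b].
Proof.
case: (hS1) (hS2) => [S10 S1D _] [S20 S2D _]; split.
  move=> [n Sn <-].
  suff : [set n | exists a b, [/\ S1 a, S2 b & n = x * a + y * b]%N] n.
    move=> [a [b [Sa Sb ->]]]; exists a%:Z, b%:Z; split; [by exists a|by exists b|].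
    by rewrite PoszD !PoszM.
  move: n Sn; apply: generated_min => /=.
  - by exists 0%N, 0%N; rewrite !muln0.
  - move=> _ _ [a [b [Sa Sb ->]]] [c [d [Sc Sd ->]]].
    by exists (a + c)%N, (b + d)%N; split; [exact: S1D|exact: S2D|lia].
  - move=> _ [] [s Ss <-].
      by exists s, 0%N; rewrite muln0 addn0.
    by exists 0%N, s; rewrite muln0.
move=> [_ [_ [[a Sa <-] [b Sb <-] ->]]].
exists (x * a + y * b)%N; last by rewrite PoszD !PoszM.
by apply: generatedD; apply: sub_generated; [left; exists a|right; exists b].
Qed.

(** Trading multiples of [x y] between the two terms of a Bezout combination brings [b] into the
    Apery set of [S2] with respect to [x]. *)
Lemma gluing_decomp z : exists a b,
  [/\ z = x%:Z * a + y%:Z * b, intset S2 b & ~ intset S2 (b - x%:Z)].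
Proof.
have [u [v ->]] := bezout_int z cxy.
have [t [Sb nSb]] := apery_congr hS2 v x0.
by exists (u - y%:Z * t), (v + x%:Z * t); split=> //; ring.
Qed.

(** The Frobenius number is written out because the case [k1 = k2 = 0] serves to establish its
    value. *)
Lemma gluing_canonical_notin k1 k2 :
  canonical_ideal S1 k1 -> canonical_ideal S2 k2 ->
  ~ intset S (x%:Z * F1 + y%:Z * F2 + x%:Z * y%:Z - (x%:Z * k1 + y%:Z * k2)).
Proof.
move=> Kk1 Kk2 /intset_gluing[a [b [Sa Sb E]]].
have [t [Ep Eq]] : exists t : int,
    F1 - k1 + y%:Z - a = y%:Z * t /\ b - F2 + k2 = x%:Z * t.
  apply: coprime_mul_eq => //; apply/eqP; rewrite -subr_eq0.
  apply/eqP; transitivity (x%:Z * F1 + y%:Z * F2 + x%:Z * y%:Z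
    - (x%:Z * k1 + y%:Z * k2) - (x%:Z * a + y%:Z * b)); first by ring.
  by rewrite E subrr.
(* The summand [x y] supplies the extra [y]: [t <= 0] puts [F2 - k2] in [S2], and [t >= 1] puts
   [F1 - k1] in [S1]. *)
have [t0|t0] := lerP t 0.
  apply: Kk2; rewrite -/F2.
  have -> : F2 - k2 = b + x%:Z * - t by rewrite mulrN -Eq; ring.
  by apply: intsetD => //; apply: intsetM => //; lia.
apply: Kk1; rewrite -/F1.
have -> : F1 - k1 = a + y%:Z * (t - 1) by rewrite mulrBr -Ep; ring.
by apply: intsetD => //; apply: intsetM => //; lia.
Qed.

Lemma frobenius_gluing :
  frobenius_number S = x%:Z * F1 + y%:Z * F2 + x%:Z * y%:Z.
Proof.
set f := RHS.
have [nSf fmax] : is_frobenius_number S f.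
  split.
    have := gluing_canonical_notin (canonical_ideal0 hS1) (canonical_ideal0 hS2).
    by rewrite !mulr0 !addr0.
  move=> z; have [a [b [-> Sb nSb]]] := gluing_decomp z => nSz.
  have aF1 : a <= F1.
    by apply: le_frobenius => // Sa; apply: nSz; apply/intset_gluing; exists a, b.
  have bF2 := le_frobenius hS2 nSb.
  by rewrite /f -/F2 in bF2 *; nia.
(* Unfolding [xget] avoids proving that [S] is a numerical semigroup; [f] itself rules out the
   default value. *)
rewrite /frobenius_number; case: xgetP => [g _ [nSg gmax]|/(_ f) []//].
by apply/eqP; rewrite eq_le fmax // gmax.
Qed.

Lemma canonical_ideal_gluing z : canonical_ideal S z <->
  exists k1 k2, [/\ canonical_ideal S1 k1, canonical_ideal S2 k2
                  & z = x%:Z * k1 + y%:Z * k2].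
Proof.
rewrite {1}/canonical_ideal /= frobenius_gluing; split; last first.
  by move=> [k1 [k2 [Kk1 Kk2 ->]]]; exact: gluing_canonical_notin.
set f := (_ + _ + _) => nSz.
have [a [b [E Sb nSb]]] := gluing_decomp (f - z).
(* The term [x y] of [f] goes to the second coordinate, where [b - x] is known to lie outside
   [S2]. *)
exists (F1 - a), (F2 + x%:Z - b); split.
- rewrite /canonical_ideal /= -/F1 (_ : F1 - (F1 - a) = a); last by ring.
  by move=> Sa; apply: nSz; apply/intset_gluing; exists a, b.
- by rewrite /canonical_ideal /= -/F2 (_ : F2 - _ = b - x%:Z); last by ring.
- have -> : z = f - (f - z) by ring.
  by rewrite E /f; ring.
Qed.

Lemma nearly_gorenstein_gluing_symmetric (m : nat) :
  S2 m -> (0 < m)%N -> (m < x)%N -> nearly_gorenstein S -> (0 < y)%N ->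
  symmetric_semigroup S1.
Proof.
move=> S2m m0 mx nG y0.
have : maximal_ideal S (y * m)%N%:Z.
  exists (y * m)%N => //; split=> /=; last by nia.
  by apply: sub_generated; right; exists m.
move/nG => [_ /canonical_ideal_gluing[k1 [k2 [Kk1 Kk2 ->]]] [w Sw Ew]].
apply: (canonical_ideal_principal hS1 Kk1) => k Kk.
have : intset S (w + (x%:Z * k + y%:Z * k2)).
  by apply: Sw; apply/canonical_ideal_gluing; exists k, k2.
have -> : w + (x%:Z * k + y%:Z * k2) = x%:Z * (k - k1) + y%:Z * m%:Z.
  by rewrite -PoszM -Ew; ring.
move=> /intset_gluing[a [b [Sa Sb E]]].
have [t [Ep Eq]] : exists t : int, k - k1 - a = y%:Z * t /\ b - m%:Z = x%:Z * t.
  apply: coprime_mul_eq => //; apply/eqP; rewrite -subr_eq0; apply/eqP.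
  transitivity (x%:Z * (k - k1) + y%:Z * m%:Z - (x%:Z * a + y%:Z * b)).
    by ring.
  by rewrite E subrr.
(* From [b >= 0] and [m < x], [x t = b - m > -x]. *)
have t0 : 0 <= t by have := intset_ge0 Sb; nia.
have -> : k - k1 = a + y%:Z * t by rewrite -Ep; ring.
by apply: intsetD => //; exact: intsetM.
Qed.

End Gluing.

(** * Exchange of the two semigroups and conclusion *)

Lemma gluingC S1 S2 x y : gluing S1 S2 x y = gluing S2 S1 y x.
Proof. by rewrite /gluing setUC. Qed.

Local Close Scope ring_scope.
Local Close Scope classical_set_scope.

Theorem proposition3p1 (S1 S2 : set nat)
    (hS1 : numerical_semigroup S1) (hS2 : numerical_semigroup S2)
    (hns : ~ symmetric_semigroup S1 \/ ~ symmetric_semigroup S2) :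
  forall S : set nat, is_gluing S1 S2 S -> ~ nearly_gorenstein S.
Proof.
move=> _ [x [y [Gx Gy cxy ->]]] nG.
(* If [x = 0], coprimality gives [y = 1], and [y] not being a minimal generator would require an
   element strictly between [0] and [1]. *)
have x0 : x <> 0%N.
  move=> xE; have y1 : y = 1%N by move: cxy; rewrite xE /coprime gcd0n => /eqP.
  have [|m [_]] := nonminimal_generator_gt hS1 Gy; lia.
have y0 : y <> 0%N.
  move=> yE; have x1 : x = 1%N by move: cxy; rewrite yE /coprime gcdn0 => /eqP.
  have [|m [_]] := nonminimal_generator_gt hS2 Gx; lia.
have [m [S2m m0 mx]] := nonminimal_generator_gt hS2 Gx x0.
have [n [S1n n0 ny]] := nonminimal_generator_gt hS1 Gy y0.
have [S2x _] := Gx; have [S1y _] := Gy.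
case: hns; apply.
  by apply: (nearly_gorenstein_gluing_symmetric hS1 hS2 S2x S1y _ cxy S2m m0 mx nG);
    lia.
rewrite gluingC in nG; rewrite coprime_sym in cxy.
by apply: (nearly_gorenstein_gluing_symmetric hS2 hS1 S1y S2x _ cxy S1n n0 ny nG);
  lia.
Qed.
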